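(* Let $(X,T)$ be a topological dynamical system, $x\in X$ and $a_1(x)$ be the type-I topological restricted asymptotic rate at $x$. Then $$a_1(x)\le\inf_{\mu\in M(X,T)}a_\mu(x),$$ where $a_\mu(x)$ is the $\mu$-restricted asymptotic rate at $x$. Moreover, $$\inf_{x\in X}a_1(x)\le\frac{1}{h_{top}(T)},$$ where $h_{top}(T)$ is the topological entropy of $(X,T)$.
   Context: A topological dynamical system $(X,T)$ is a compact metric space $X$ with metric $\rho$ together with a continuous map $T:X\to X$. $M(X,T)$ is the set of $T$-invariant Borel probability measures on $X$. For $\mu\in M(X,T)$, $\mathscr{B}_\mu^+$ is the collection of Borel sets $V\subseteq X$ with $\mu(V)>0$. $\mu$-restricted asymptotic rate: for $x\in X$, $\delta>0$ and $\mu\in M(X,T)$, a real number $a>0$ is a $\mu$-asymptotic rate at $x$ w.r.t. $\delta$ if for every $V\in\mathscr{B}_\mu^+$ there is a nonnegative integer $n\le -a\log\mu(V)$ with $\mu(\{y\in V:\rho(T^nx,T^ny)>\delta\})>0$. $a_\mu(x,\delta)$ is the infimum of all such $a$ ($+\infty$ if there are none); it does not increase as $\delta$ decreases, and $a_\mu(x)=\lim_{\delta\to0}a_\mu(x,\delta)\in[0,+\infty]$. Capacity: for $V\subseteq X$, $c(V)=\inf_{x\in X}\limsup_{n\to\infty}\frac1n\sum_{i=0}^{n-1}\chi_V(T^ix)$, where $\chi_V$ is the indicator function of $V$. Let $OC(X,T)=\{V\subseteq X: V\text{ is open and }c(V)>0\}$. Type-I topological restricted asymptotic rate: for $x\in X$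 and $\delta>0$, $T$ is type-I topological restricted sensitive at $x$ w.r.t. $\delta$ if there exists a real number $a>0$ such that for every $V\in OC(X,T)$ there exist a nonnegative integer $n\le -a\log c(V)$ and $y\in V$ with $\rho(T^nx,T^ny)>\delta$. $a_1(x,\delta)$ is the infimum of all such $a>0$, with $a_1(x,\delta)=+\infty$ if there are none. It does not increase as $\delta$ decreases, and $a_1(x)=\lim_{\delta\to0}a_1(x,\delta)\in[0,+\infty]$ (with $a_1(x)=+\infty$ if $a_1(x,\delta)=+\infty$ for all $\delta>0$). Conventions: $\frac10=+\infty$ and $\frac{1}{+\infty}=0$. *)

(* Defs.v *)
From HB Require Import structures.
From mathcomp Require Import all_boot all_order all_algebra finmap.
From mathcomp Require Import all_classical all_reals all_analysis.

Set Implicit Arguments.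
Unset Strict Implicit.
Unset Printing Implicit Defensive.

Import Order.TTheory GRing.Theory Num.Theory.
Import numFieldNormedType.Exports.

Local Open Scope classical_set_scope.
Local Open Scope ring_scope.

(* Nonempty metric spaces: the library's measurable types are pointed, so a
   point is needed to put a Borel sigma-algebra on a metric space. *)
#[short(type="pointedMetricType")]
HB.structure Definition PointedMetric (K : numDomainType) :=
  {M of Metric K M & Pointed M}.

Section dynamical_system.
Context {R : realType} {X : pointedMetricType R}.
Implicit Types (T : X -> X) (x y z : X) (delta a : R) (n : nat) (V : set X).
Local Open Scope ereal_scope.

Definition borel_type := g_sigma_algebraType (@open X).

Implicit Type mu : probability borel_type R.

Definition invariant_probabilities T : set (probability borel_type R) :=
  [set mu | forall A : set borel_type, measurable A -> mu (T @^-1` A) = mu A].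

Definition separates T delta n x y : Prop :=
  (delta < mdist (iter n T x) (iter n T y))%R.

Definition is_mu_rate T mu x delta a : Prop :=
  (0 < a)%R /\
  forall V : set borel_type, measurable V -> 0 < mu V ->
    exists n, n%:R%:E <= - (a%:E * lne (mu V)) /\
              0 < mu [set y | V y /\ separates T delta n x y].

Definition mu_rate_at T mu x delta : \bar R :=
  ereal_inf [set a%:E | a in is_mu_rate T mu x delta].

Definition mu_rate T mu x : \bar R :=
  lim (mu_rate_at T mu x delta @[delta --> (0 : R)%R^'+]).

Definition visit_frequency T V x n : R :=
  (n%:R^-1 * \sum_(0 <= i < n) \1_V (iter i T x))%R.

Definition capacity T V : \bar R :=
  ereal_inf
    [set limn_esup (fun n => (visit_frequency T V x n)%:E) | x in [set: X]].

Definition OC T : set (set X) := [set V | open V /\ 0 < capacity T V].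

Definition is_type1_rate T x delta a : Prop :=
  (0 < a)%R /\
  forall V, OC T V ->
    exists n, n%:R%:E <= - (a%:E * lne (capacity T V)) /\
              exists y, V y /\ separates T delta n x y.

Definition type1_rate_at T x delta : \bar R :=
  ereal_inf [set a%:E | a in is_type1_rate T x delta].

Definition type1_rate T x : \bar R :=
  lim (type1_rate_at T x delta @[delta --> (0 : R)%R^'+]).

(* Topological entropy in Bowen's form, through (n, eps)-separated sets. *)
Definition separated_set T n (eps : R) (E : {fset X}) : Prop :=
  forall y z, y \in E -> z \in E -> y <> z ->
    exists2 i, (i < n)%N & separates T eps i y z.

Definition max_separated T n (eps : R) : \bar R :=
  ereal_sup [set (#|` E |%:R)%:E | E in separated_set T n eps].

Definition entropy_at T (eps : R) : \bar R :=
  limn_esup (fun n => (n%:R^-1)%:E * lne (max_separated T n eps)).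

Definition htop T : \bar R := lim (entropy_at T eps @[eps --> (0 : R)%R^'+]).

End dynamical_system.
Arguments borel_type {R} X.

(* Main.v *)
Require Import Defs.
From mathcomp Require Import all_boot all_order all_algebra finmap.
From mathcomp Require Import all_classical all_reals all_analysis.
From mathcomp Require Import measurable_realfun ring lra.
Import Order.TTheory GRing.Theory Num.Theory.
Import numFieldNormedType.Exports.

(** The argument rests on one reformulation of capacity.  If V is open and
    c < c(V), every orbit reaches, after boundedly many steps, a time at which
    its frequency of visits to V is at least c (the bound comes from
    compactness, as this condition is open in the starting point).  Chaining
    these orbit pieces shows that every orbit segment of length n visits V at
    least c n - D times, with D independent of the segment
    ([visited_lt_capacity]).

    First inequality.  Integrating c n - D <= S_n against an invariant
    probability mu gives c(V) <= mu(V) ([capacity_le_invariant]).  Hence a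
    mu-rate is also a topological rate: c(V) <= mu(V) enlarges the range of
    times n allowed, and a set of positive measure has a point.  The limits as
    delta tends to 0 are compared through monotonicity in delta.

    Second inequality.  Suppose a is smaller than every a_1(x) and
    1 / a < s < h_top.  Put q = exp (- 1 / a) and r = exp (- s), so r < q.
    That a fails to be a rate at x for delta says that some open V lies in a
    Bowen ball of length m and radius delta about x and is visited by all
    orbits at rate q ^ m.  The rates of disjoint sets sum to at most 1
    ([sum_visit_rates_le1]), so visit rates replace the invariant measure of
    the usual entropy distribution argument: a finite Vitali selection
    produces a finite cover of X by Bowen balls with lengths m_i and
    sum of the r ^ m_i at most 1 ([card_separated_of_visits]).  Splitting
    an (n, eps)-separated set along such a cover and applying T ^ m_i to the
    pieces bounds its cardinal by a constant times r ^ - n, by induction on n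
    ([card_separated_le]).  Thus the entropy at scale eps is at most s for
    every eps, contradicting s < h_top.

    To make the sum small the lengths m_i must exceed a given m0, which can
    only fail at points x all of whose neighbourhoods contain sets visited at
    rate q ^ m0.  Again because rates of disjoint sets sum to at most 1, there
    are at most q ^ - m0 such points ([size_clustered]), and covering each of
    them by one very long Bowen ball costs little. *)

Set Implicit Arguments.
Unset Strict Implicit.
Unset Printing Implicit Defensive.
Local Open Scope classical_set_scope.
Local Open Scope ring_scope.

(** * Limits of real and extended real quantities *)

Section limits.
Context {R : realType}.

Lemma le_slope (c b D : R) :
  (forall n : nat, c * n%:R - D <= b * n%:R) -> c <= b.
Proof.
move=> cb; rewrite leNgt; apply/negP => bc.
pose n := (Num.truncn (D / (c - b))).+1.
have cb0 : 0 < c - b by rewrite subr_gt0.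
have : D / (c - b) < n%:R by rewrite truncnS_gt.
by rewrite ltr_pdivrMr// => Dn; have := cb n; nra.
Qed.

Lemma exprn_small (r e : R) : 0 < r -> r < 1 -> 0 < e -> exists n, r ^+ n <= e.
Proof.
move=> r0 r1 e0; have rn1 : `|r| < 1 by rewrite gtr0_norm.
have /cvgrPdist_le/(_ e e0)[n _ /(_ n (leqnn n))] := cvg_expr rn1.
by rewrite /= sub0r normrN normrX gtr0_norm// => ?; exists n.
Qed.

Local Open Scope ereal_scope.

Lemma lte_EFin_between (a b : \bar R) : a < b -> exists r : R, a < r%:E < b.
Proof.
case: a b => [a||] [b||] //; rewrite ?ltxx//.
- rewrite lte_fin => ab; exists ((a + b) / 2)%R.
  by rewrite !lte_fin !(midf_lt ab).
- by move=> _; exists (a + 1)%R; rewrite lte_fin ltrDl ltr01 ltry.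
- by move=> _; exists (b - 1)%R; rewrite lte_fin gtrDl ltrN10 ltNyr.
- by move=> _; exists 0%R; rewrite ltNyr ltry.
Qed.

Lemma lim_at_right0_nondecreasing (f : R -> \bar R) :
  (forall d e : R, (0 < d)%R -> (d <= e)%R -> f d <= f e) ->
  lim (f d @[d --> (0 : R)%R^'+]) =
  ereal_inf [set f d | d in [set d : R | (0 < d)%R]].
Proof.
move=> ndf; have := @nondecreasing_at_right_cvge R f 0%R +oo%O.
rewrite set_itvE; move=> H; apply/cvg_lim => //; apply: H => // x y.
by rewrite !in_itv/= !andbT => x0 _; exact: ndf.
Qed.

Lemma lim_at_right0_nonincreasing (f : R -> \bar R) :
  (forall d e : R, (0 < d)%R -> (d <= e)%R -> f e <= f d) ->
  lim (f d @[d --> (0 : R)%R^'+]) =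
  ereal_sup [set f d | d in [set d : R | (0 < d)%R]].
Proof.
move=> nif; have := @nonincreasing_at_right_cvge R f 0%R +oo%O.
rewrite set_itvE; move=> H; apply/cvg_lim => //; apply: H => // x y.
by rewrite !in_itv/= !andbT => x0 _; exact: nif.
Qed.

Lemma le_limn_esup (u v : (\bar R)^nat) : (forall n, u n <= v n) ->
  limn_esup u <= limn_esup v.
Proof.
move=> uv; rewrite !limn_esup_lim; apply: lee_lim; [exact: is_cvg_esups..|].
apply: nearW => n; apply/ereal_supP => _ [k /= nk <-]; apply: le_trans (uv k) _.
by apply: ereal_sup_ubound; exists k.
Qed.

Lemma limn_esup_near_le (u : (\bar R)^nat) (l : \bar R) :
  (\forall n \near \oo, (u n <= l)%E) -> (limn_esup u <= l)%E.
Proof.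
move=> [N _ uN]; rewrite limn_esup_lim.
apply: lime_le; first exact: is_cvg_esups.
near=> n; apply/ereal_supP => _ [k /= nk <-]; apply: uN.
by apply: leq_trans nk; near: n; exists N.
Unshelve. all: by end_near. Qed.

End limits.

(** * Finite selection and counting *)

(** A finite Vitali covering argument for sets that shrink as their index m
    grows.  Treating the sets by increasing m and keeping one only if it misses
    those already kept, each discarded set meets a kept set of smaller or equal
    index. *)
Lemma vitali_selection (X : Type) (I : eqType) (m : I -> nat) (V : I -> set X)
    (s : seq I) : uniq s ->
  exists J : seq I, [/\ {subset J <= s}, uniq J,
    {in J &, forall i j, i != j -> V i `&` V j = set0} &
    {in s, forall i, exists2 j, j \in J &
      (m j <= m i)%N /\ (i = j \/ V i `&` V j !=set0)}].
Proof.
wlog ss : s / sorted (fun i j => m j <= m i)%N s.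
  move=> H us.
  have [||J [Js uJ dJ cJ]] := H (sort (fun i j => m j <= m i)%N s).
  - by apply: sort_sorted => i j; exact: leq_total.
  - by rewrite sort_uniq.
  exists J; split=> // [i /Js|i si]; first by rewrite mem_sort.
  by apply: cJ; rewrite mem_sort.
elim: s ss => [_ _|i s IH ss /= /andP[iNs us]]; first by exists [::].
have [J [Js uJ dJ cJ]] := IH (path_sorted ss) us.
have ms j : j \in s -> (m j <= m i)%N.
  move=> js.
  have /(_ _ _ _ ss)/allP := @order_path_min _ (fun i j => m j <= m i)%N.
  by apply=> // k l n kl nk; exact: leq_trans nk kl.
have [[j jJ Vij]|nJ] := pselect (exists2 j, j \in J & V i `&` V j !=set0).
  exists J; split=> // [k /Js|k]; first by rewrite inE => ->; rewrite orbT.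
  rewrite inE => /predU1P[->|/cJ//]; exists j => //.
  by split; [exact/ms/Js|right].
have dVi j : j \in J -> V i `&` V j = set0.
  move=> jJ; apply: contrapT => /eqP/set0P Vij.
  by apply: nJ; exists j.
exists (i :: J); split=> [j||j k|j].
- by rewrite !inE => /predU1P[->|/Js ->]; rewrite ?eqxx ?orbT.
- by rewrite /= uJ andbT; apply: contra iNs => /Js.
- rewrite !inE => /predU1P[->|jJ] /predU1P[->|kJ] jk.
  + by rewrite eqxx in jk.
  + exact: dVi.
  + by rewrite setIC dVi.
  + exact: dJ.
- rewrite inE => /predU1P[->|/cJ[k kJ mk]].
    by exists i; rewrite ?mem_head//; split; last left.
  by exists k; rewrite // inE kJ orbT.
Qed.

Lemma card_fset_filter (X : choiceType) (E : {fset X}) (p : pred X) :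
  #|` [fset y in E | p y]%fset| = count p E.
Proof.
rewrite -size_filter; apply/perm_size/uniq_perm;
  rewrite ?filter_uniq ?fset_uniq//.
by move=> y; rewrite mem_filter !inE andbC.
Qed.

Lemma size_le_sum_count (I J : Type) (s : seq I) (p : I -> pred J) (t : seq J) :
  all (fun y => has (p^~ y) s) t -> (size t <= \sum_(x <- s) count (p x) t)%N.
Proof.
elim: t => //= y t IH /andP[sy /IH]; rewrite big_split/=.
move=> H; rewrite -add1n leq_add//.
rewrite has_count -sum1_count in sy; apply: leq_trans sy _.
by rewrite big_mkcond/=; apply: leq_sum => x _; case: (p x y).
Qed.

(** * Uniform visit rates *)

Section visits.
Context {R : realType} {X : pointedMetricType R} (T : X -> X).
Implicit Types (V W : set X) (c d : R).

Definition visits V (x : X) (n : nat) : R :=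
  \sum_(0 <= i < n) \1_V (iter i T x).

(** The additive constant D, uniform over all orbits, is what makes such rates
    add up over disjoint sets, where the infimum and upper limit defining
    capacity behave badly under sums. *)
Definition visited_at_rate V c : Prop :=
  exists D : R, forall x n, c * n%:R - D <= visits V x n.

Lemma visits_ge0 V x n : 0 <= visits V x n.
Proof. by apply: sumr_ge0 => i _; rewrite indicE. Qed.

Lemma visits_le V x n : visits V x n <= n%:R.
Proof.
rewrite /visits big_mkord -[leRHS]mulr1 -[X in X%:R * 1]card_ord.
rewrite mulr_natl -sumr_const.
by apply: ler_sum => i _; rewrite indicE; case: (_ \in _).
Qed.

Lemma visitsD V x m n :
  visits V x (m + n) = visits V x m + visits V (iter m T x) n.
Proof.
rewrite /visits (@big_cat_nat _ _ _ m) ?leq_addr//=; congr (_ + _).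
rewrite -{1}[m]add0n big_addn addKn.
by apply: eq_bigr => i _; rewrite iterD.
Qed.

Lemma visitsU V W x n : V `&` W = set0 ->
  visits (V `|` W) x n = visits V x n + visits W x n.
Proof.
move=> VW; rewrite /visits -big_split/=; apply: eq_bigr => i _.
rewrite !indicE in_setU.
have [iV|] := boolP (_ \in V); have [iW|] := boolP (_ \in W);
  rewrite ?addr0 ?add0r//.
have : (V `&` W) (iter i T x) by split; rewrite -inE.
by rewrite VW.
Qed.

Lemma visited_at_rate_le1 V c : visited_at_rate V c -> c <= 1.
Proof.
move=> [D VD]; apply: (@le_slope _ _ _ D) => n; rewrite mul1r.
exact: le_trans (VD point n) (visits_le _ _ _).
Qed.

Lemma visited_at_rateW V c c' :
  c' <= c -> visited_at_rate V c -> visited_at_rate V c'.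
Proof.
move=> cc [D VD]; exists D => x n; apply: le_trans (VD x n).
by rewrite lerD2r ler_wpM2r.
Qed.

(** An orbit segment visits pairwise disjoint sets at different times; dividing
    the total number of visits by the length gives the bound, and the role of a
    probability measure is played by these rates from here on. *)
Lemma sum_visit_rates_le1 (I : eqType) (s : seq I) (V : I -> set X)
    (c : I -> R) :
  uniq s -> {in s &, forall i j, i != j -> V i `&` V j = set0} ->
  {in s, forall i, visited_at_rate (V i) (c i)} -> \sum_(i <- s) c i <= 1.
Proof.
move=> us dV vV.
apply: (@visited_at_rate_le1 [set y | exists2 i, i \in s & V i y]).
elim: s us dV vV => [|i s IH] /=.
  by move=> _ _ _; exists 0 => x n; rewrite big_nil mul0r subr0 visits_ge0.
move=> /andP[iNs us] dV vV.
have [D1 VD1] : visited_at_rate (V i) (c i) by apply: vV; rewrite mem_head.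
have [||D2 VD2] := IH us.
- by move=> j k js ks; apply: dV; rewrite inE ?js ?ks orbT.
- by move=> j js; apply: vV; rewrite inE js orbT.
exists (D1 + D2) => x n.
have -> : [set y | exists2 j, j \in i :: s & V j y] =
    V i `|` [set y | exists2 j, j \in s & V j y].
  apply/seteqP; split=> y /=.
    move=> [j]; rewrite inE => /predU1P[->|js] Vjy; first by left.
    by right; exists j.
  case=> [Viy|[j js Vjy]]; first by exists i; rewrite ?mem_head.
  by exists j; rewrite // inE js orbT.
rewrite visitsU; last first.
  rewrite -subset0 => y [Viy [j js Vjy]].
  have ij : i != j by apply: contraNneq iNs => ->.
  have : (V i `&` V j) y by split.
  by rewrite dV// ?inE ?eqxx ?js ?orbT.
by rewrite big_cons; have := VD1 x n; have := VD2 x n; nra.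
Qed.

Section compact.
Hypotheses (cptX : compact [set: X]) (contT : continuous T).

Lemma continuous_iter i : continuous (iter i T).
Proof.
elim: i => [|i IH] x; first exact: cvg_id.
rewrite (_ : iter i.+1 T = T \o iter i T)//.
exact: (@continuous_comp _ _ _ (iter i T) T x (IH x) (@contT _)).
Qed.

Lemma nbhs_cover (U : X -> set X) : (forall x, nbhs x (U x)) ->
  exists D : {fset X}, forall y, exists2 x, x \in D & U x y.
Proof.
move=> nU; move: cptX; rewrite compact_cover => cX.
have [D _ DU] : finite_subset_cover [set: X] (fun x => (U x)°) [set: X].
  apply: cX => [x _|y _]; first exact: open_interior.
  by exists y => //; exact: nU.
exists D => y; have [x xD /interior_subset Uxy] := DU y I.
by exists x.
Qed.

(** Visiting an open set at given finitely many times is an open condition, so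
    the number of visits is lower semicontinuous in the starting point. *)
Lemma near_visits_ge V x n : open V ->
  \forall y \near x, visits V x n <= visits V y n.
Proof.
move=> oV.
have : \forall y \near x, forall i : 'I_n, V (iter i T x) -> V (iter i T y).
  apply: filter_forall => i.
  have [Vx|nV] := pselect (V (iter i T x)); last exact: nearW.
  have : \forall y \near x, V (iter i T y).
    by apply: continuous_iter; exact: open_nbhs_nbhs.
  by apply: filterS => y.
apply: filterS => y Vxy; rewrite /visits !big_mkord; apply: ler_sum => i _.
rewrite !indicE; case: (boolP (_ \in V)) => //=.
by rewrite inE => /Vxy; rewrite -inE => ->.
Qed.

(** By compactness the return lengths t can be bounded by some N.  Cutting an
    orbit segment into pieces of these lengths, each visited at rate c, leaves a
    remainder shorter than N, whence the constant c N. *)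
Lemma visited_at_rate_local V c : open V -> 0 <= c ->
  (forall x, exists2 n, (0 < n)%N & c * n%:R <= visits V x n) ->
  visited_at_rate V c.
Proof.
move=> oV c0 H.
have /choice[t {}H] x : exists n, (0 < n)%N /\ c * n%:R <= visits V x n.
  by have [n n0 cn] := H x; exists n.
have t0 x := (H x).1; have ct x := (H x).2.
have [D tD] := nbhs_cover (fun x => near_visits_ge x (t x) oV).
pose N := \max_(x <- D) t x.
have tN x : x \in D -> (t x <= N)%N by move=> xD; exact: leq_bigmax_seq.
exists (c * N%:R) => y n; elim/ltn_ind: n y => n IH y.
have [nN|Nn] := leqP n N.
  rewrite -mulrBr (le_trans _ (visits_ge0 _ _ _))// mulr_ge0_le0//.
  by rewrite subr_le0 ler_nat.
have [x xD txy] := tD y.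
have txn : (t x <= n)%N by rewrite (leq_trans (tN _ xD))// ltnW.
rewrite -(subnKC txn) visitsD natrD.
have := IH (n - t x)%N _ (iter (t x) T y).
rewrite ltn_subrL t0 (leq_trans (t0 x) txn) => /(_ isT).
by have := ct x; lra.
Qed.

Lemma visited_lt_capacity V c : open V -> 0 <= c ->
  (c%:E < capacity T V)%E -> visited_at_rate V c.
Proof.
move=> oV c0 cV; apply: visited_at_rate_local => // x; apply/not_exists2P => H.
move: cV; rewrite ltNge => /negP; apply.
apply: ereal_inf_le; exists (limn_esup (fun n => (visit_frequency T V x n)%:E)).
  by exists x.
apply: limn_esup_near_le; apply: nearW => n; rewrite lee_fin /visit_frequency.
have [->|n0] := posnP n; first by rewrite big_geq// mulr0.
have [//|/negP] := H n; rewrite -ltNge => /ltW.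
by rewrite ler_pdivrMl ?ltr0n// mulrC.
Qed.

End compact.
End visits.

(** * Bowen balls and separated sets *)

Section bowen.
Context {R : realType} {X : pointedMetricType R} (T : X -> X).
Implicit Types (V W : set X) (c d : R).

(** Closed balls are used because failing to separate at scale d means staying
    at distance at most d. *)
Definition bowen_ball (m : nat) (x : X) d : set X :=
  [set y | forall i, (i < m)%N -> mdist (iter i T x) (iter i T y) <= d].

Lemma bowen_ball_overlap m n x y z d : (m <= n)%N ->
  bowen_ball m x d z -> bowen_ball n y d z ->
  bowen_ball n y (2 * d) `<=` bowen_ball m x (4 * d).
Proof.
move=> mn xz yz w yw i im; have ilt : (i < n)%N by exact: leq_trans im mn.
have /= h1 := xz i im; have /= h2 := yz i ilt; have /= h3 := yw i ilt.
have := metric_triangle (iter i T x) (iter i T z) (iter i T w).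
have := metric_triangle (iter i T z) (iter i T y) (iter i T w).
by rewrite (metric_sym (iter i T z) (iter i T y)); lra.
Qed.

Lemma bowen_ball_sub m n x d e : (m <= n)%N -> d <= e ->
  bowen_ball n x d `<=` bowen_ball m x e.
Proof.
move=> mn de y H i im; apply: le_trans de; apply: H; exact: leq_trans mn.
Qed.

Lemma separated_set_sub n eps (E F : {fset X}) :
  (F `<=` E)%fset -> separated_set T n eps E -> separated_set T n eps F.
Proof. by move=> /fsubsetP FE sE y z /FE yE /FE; exact: sE. Qed.

Lemma bowen_ball_within m x d y z i :
  bowen_ball m x d y -> bowen_ball m x d z -> (i < m)%N ->
  ~ separates T (2 * d) i y z.
Proof.
move=> xy xz im; rewrite /separates; apply/negP; rewrite -leNgt.
have := xy i im; have := xz i im.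
have := metric_triangle (iter i T y) (iter i T x) (iter i T z).
by rewrite (metric_sym (iter i T y) (iter i T x)); lra.
Qed.

(** Two points of the same Bowen ball of length m cannot be separated before
    time m, so T ^ m carries E injectively to a set whose points are separated
    within the remaining n - m steps. *)
Lemma card_separated_bowen_ball n m x d (E : {fset X}) : 0 <= d ->
  separated_set T n (2 * d) E -> {in E, forall y, bowen_ball m x d y} ->
  exists F : {fset X}, separated_set T (n - m) (2 * d) F /\ #|` F | = #|` E |.
Proof.
move=> d0 sE EB; exists [fset iter m T y | y in E]%fset.
have sep y z : y \in E -> z \in E -> y <> z ->
    exists2 i, (i < n - m)%N & separates T (2 * d) i (iter m T y) (iter m T z).
  move=> yE zE yz; have [i iltn] := sE y z yE zE yz.
  have [im|mi] := ltnP i m.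
    by move=> /(bowen_ball_within (EB _ yE) (EB _ zE) im).
  rewrite -[X in separates _ _ X](subnK mi) /separates !iterD => s.
  by exists (i - m)%N => //; rewrite ltn_sub2r// (leq_ltn_trans mi).
split.
  move=> _ _ /imfsetP[/= y yE ->] /imfsetP[/= z zE ->] yz.
  by apply: sep => // yz'; apply: yz; rewrite yz'.
apply: card_in_imfset => y z yE zE Tyz.
apply: contrapT => /(sep _ _ yE zE)[i _].
by rewrite /separates Tyz mdistxx ltNge mulr_ge0.
Qed.

Lemma card_separated0 eps (E : {fset X}) :
  separated_set T 0 eps E -> (#|` E| <= 1)%N.
Proof.
move=> sE; have [->|[y yE]] := fset_0Vmem E; first by rewrite cardfs0.
rewrite -(cardfs1 y); apply/fsubset_leq_card/fsubsetP => z zE; rewrite inE.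
apply/eqP; apply: contrapT => zy; by have [] := sE _ _ zE yE zy.
Qed.

(** The cover splits a set separated within n steps into pieces, and the piece
    in the ball about x becomes a set separated within n - m x steps; so the
    maximal cardinals f satisfy f n <= sum of the f (n - m x), and the condition
    on the sum of the r ^ m x makes C r ^ - n a supersolution. *)
Lemma card_separated_le (s : seq X) (m : X -> nat) (r d : R) :
  0 <= d -> 0 < r -> r <= 1 ->
  {in s, forall x, (0 < m x)%N} ->
  (forall y, exists2 x, x \in s & bowen_ball (m x) x d y) ->
  \sum_(x <- s) r ^+ m x <= 1 ->
  exists2 C, 0 < C & forall n E, separated_set T n (2 * d) E ->
    #|` E|%:R * r ^+ n <= C.
Proof.
move=> d0 r0 r1 m0 cov sum1.
have rX_le1 k : r ^+ k <= 1 by rewrite exprn_ile1// ltW.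
(* The terms r ^- m x ensure 1 <= C r ^ m x, which handles the pieces whose
   length m x exceeds n: they have at most one point. *)
pose C := 1 + \sum_(x <- s) r ^- m x.
have sum0 (t : seq X) : 0 <= \sum_(x <- t) r ^- m x.
  by rewrite sumr_ge0// => x _; rewrite invr_ge0 exprn_ge0 ?ltW.
have C1 : 1 <= C by rewrite lerDl.
have Cm x : x \in s -> 1 <= C * r ^+ m x.
  move=> xs; rewrite -ler_pdivrMr ?exprn_gt0// mul1r /C.
  rewrite (perm_big _ (perm_to_rem xs)).
  by rewrite big_cons addrCA lerDl addr_ge0.
exists C; first exact: lt_le_trans C1.
elim/ltn_ind => n IH E sE.
have [n0|n_gt0] := posnP n.
  rewrite n0 in sE *; rewrite expr0 mulr1; apply: le_trans C1; rewrite lern1.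
  exact: card_separated0 sE.
have Ecount : (#|` E| <=
    \sum_(x <- s) count (fun y => `[< bowen_ball (m x) x d y >]) E)%N.
  apply: size_le_sum_count; apply/allP => y _; apply/hasP.
  by have [x xs xy] := cov y; exists x; rewrite //; exact/asboolP.
rewrite -(ler_nat R) natr_sum in Ecount.
apply: le_trans (ler_wpM2r (exprn_ge0 n (ltW r0)) Ecount) _; rewrite mulr_suml.
have C0 : 0 <= C by exact: le_trans C1.
rewrite -[leRHS]mulr1; apply: le_trans (ler_wpM2l C0 sum1); rewrite mulr_sumr.
rewrite big_seq [leRHS]big_seq; apply: ler_sum => x xs.
rewrite -card_fset_filter; set Ex := [fset _ in _ | _]%fset.
have sEx : separated_set T n (2 * d) Ex.
  by apply: separated_set_sub sE; apply/fsubsetP => y; rewrite !inE => /andP[].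
have [|F [sF <-]] := card_separated_bowen_ball d0 sEx (m := m x) (x := x).
  by move=> y; rewrite !inE => /andP[_ /asboolP].
have [mn|nm] := leqP (m x) n.
  rewrite -{1}(subnK mn) exprD mulrA ler_wpM2r ?exprn_ge0 ?(ltW r0)//.
  by apply: (IH _ _ F sF); rewrite ltn_subrL m0.
have F1 : (#|` F|%:R : R) <= 1.
  rewrite lern1; apply: (@card_separated0 (2 * d)).
  by move: sF; rewrite (eqP (ltnW nm : n - m x == 0)%N).
apply: le_trans (Cm _ xs).
by rewrite mulr_ile1 ?exprn_ge0 ?(ltW r0).
Qed.

Definition clustered c x : Prop := forall d, 0 < d ->
  exists V, V `<=` [set y | mdist x y <= d] /\ visited_at_rate T V c.

(** About finitely many such points one can take disjoint balls, each
    containing a set visited at rate c. *)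
Lemma size_clustered c (s : seq X) :
  uniq s -> {in s, forall x, clustered c x} ->
  (size s)%:R * c <= 1.
Proof.
move=> us sc.
have [d d0 dP] : exists2 d, 0 < d &
    {in s &, forall x y, x != y -> 2 * d < mdist x y}.
  have sep : \forall d \near (0 : R)^'+, forall ij : 'I_(size s) * 'I_(size s),
      tnth (in_tuple s) ij.1 != tnth (in_tuple s) ij.2 ->
      2 * d < mdist (tnth (in_tuple s) ij.1) (tnth (in_tuple s) ij.2).
    apply: filter_forall => -[i j] /=; set x := tnth _ i; set y := tnth _ j.
    have [_|xy] := eqVneq x y; first exact: nearW.
    have xy2 : 0 < mdist x y / 2 by rewrite divr_gt0// mdist_gt0.
    apply: filterS (nbhs_right_lt xy2) => d dxy _.
    by rewrite mulrC -ltr_pdivlMr.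
  near (0 : R)^'+ => d; exists d; first by near: d; exact: nbhs_right_gt.
  move=> x y /seq_tnthP[i ->] /seq_tnthP[j ->]; exact: (near sep d _ (i, j)).
have /choice[V VP] x : exists V, x \in s ->
    V `<=` [set y | mdist x y <= d] /\ visited_at_rate T V c.
  have [xs|] := boolP (x \in s); last by exists set0.
  by have [V VP] := sc x xs d d0; exists V.
have := @sum_visit_rates_le1 R X T X s V (fun=> c) us.
rewrite big_const_seq count_predT iter_addr_0 mulr_natl; apply; last first.
  by move=> x xs; exact: (VP x xs).2.
move=> x y xs ys xy; rewrite -subset0 => z [Vx Vy].
have /= h1 := (VP x xs).1 z Vx; have /= h2 := (VP y ys).1 z Vy.
have := metric_triangle x z y; have := dP x y xs ys xy.
by rewrite (metric_sym z y); lra.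
Unshelve. all: by end_near. Qed.

Section compact.
Hypotheses (cptX : compact [set: X]) (contT : continuous T).

Lemma nbhs_bowen_ball m x d : 0 < d -> nbhs x (bowen_ball m x d).
Proof.
move=> d0.
have : \forall y \near x, forall i : 'I_m, ball (iter i T x) d (iter i T y).
  apply: filter_forall => i.
  have /(_ (ball (iter i T x) d)) := @continuous_iter R X T contT i x.
  by apply; exact: nbhsx_ballx.
apply: filterS => y xy i im; have := xy (Ordinal im).
by rewrite ballEmdist /= => /ltW.
Qed.

(** The entropy distribution argument.  Every x has a Bowen ball B of length m
    containing a set visited at rate q ^ m.  A Vitali selection makes these sets
    disjoint while the balls of four times the radius still cover, so the sum of
    the q ^ m is at most 1; replacing q by the smaller r gains a factor
    (r / q) ^ m <= 1 / 2 provided m >= m0.  Where small radii do not force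
    m >= m0 the point is clustered at rate c = q ^ m0; at most 1 / c points are,
    so giving each of them a ball of length M with r ^ M <= c / 2 adds at most
    1 / 2 to the sum. *)
Lemma card_separated_of_visits q r d : 0 < r -> r < q -> q <= 1 -> 0 < d ->
  (forall x e, 0 < e -> exists m V, [/\ (0 < m)%N,
    V `<=` bowen_ball m x e & visited_at_rate T V (q ^+ m)]) ->
  exists2 C, 0 < C & forall n E, separated_set T n (8 * d) E ->
    #|` E|%:R * r ^+ n <= C.
Proof.
move=> r0 rq q1 d0 H; have q0 : 0 < q := lt_trans r0 rq.
have r1 : r < 1 := lt_le_trans rq q1.
have qX0 k : 0 < q ^+ k by rewrite exprn_gt0.
have rq0 : 0 < r / q by rewrite divr_gt0.
have rq1 : r / q < 1 by rewrite ltr_pdivrMr// mul1r.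
have half0 : 0 < 2^-1 :> R by rewrite invr_gt0 ltr0n.
have [m0 m0P] := exprn_small rq0 rq1 half0.
have qX1 k : q ^+ k <= 1 by rewrite exprn_ile1// ltW.
set c := q ^+ m0.
have c2 : 0 < c / 2 by rewrite divr_gt0 ?qX0.
have [M MP] := exprn_small r0 r1 c2.
have M0 : (0 < M)%N.
  rewrite lt0n; apply/negP => /eqP M0; move: MP; rewrite M0 expr0.
  have := qX1 m0; rewrite -/c; lra.
have /choice[f fP] x : exists mV : nat * set X,
    [/\ (0 < mV.1)%N, clustered c x -> mV.1 = M &
      ~ clustered c x -> [/\ (m0 <= mV.1)%N, mV.2 `<=` bowen_ball mV.1 x d &
        visited_at_rate T mV.2 (q ^+ mV.1)]].
  have [cx|ncx] := pselect (clustered c x); first by exists (M, set0); split.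
  have /existsNP[e /not_implyP[e0 ex]] := ncx.
  (* At a radius refuting the clustering, a length below m0 would give a set
     visited at rate at least q ^ m0. *)
  have [|m [V [mgt0 VB Vq]]] := H x (Num.min d e); first by rewrite lt_min d0.
  exists (m, V); split=> //= _; split=> //.
    rewrite leqNgt; apply/negP => mm0; apply: ex; exists V; split.
      by move=> y /VB /(_ 0%N mgt0) /=; rewrite le_min => /andP[].
    by apply: visited_at_rateW Vq; rewrite ler_wiXn2l ?(ltW q0) ?(ltnW mm0).
  by apply: (subset_trans VB); apply: bowen_ball_sub; rewrite // ge_min lexx.
pose m x := (f x).1; pose V x := (f x).2.
have mgt0 x : (0 < m x)%N by have [] := fP x.
have d20 : 0 < 2 * d by rewrite mulr_gt0.
have [D DP] := nbhs_cover cptX (fun x => nbhs_bowen_ball (m x) x d20).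
pose B := [seq x <- D | `[< clustered c x >]].
pose G := [seq x <- D | ~~ `[< clustered c x >]].
have [|J [JG uJ dJ cJ]] := vitali_selection m V (s := G).
  by rewrite filter_uniq// fset_uniq.
have Jgood x : x \in J -> [/\ (m0 <= m x)%N, V x `<=` bowen_ball (m x) x d &
    visited_at_rate T (V x) (q ^+ m x)].
  move=> /JG; rewrite mem_filter => /andP[/asboolPn nx _].
  by have [_ _ /(_ nx)] := fP x.
rewrite (_ : 8 * d = 2 * (4 * d)); last by ring.
apply: (@card_separated_le (B ++ J) m) => //;
  [by rewrite mulr_ge0 ?ltW|exact: ltW| |].
  move=> y; have [x xD xy] := DP y.
  have le24 : 2 * d <= 4 * d by lra.
  have [cx|nx] := boolP `[< clustered c x >].
    exists x; first by rewrite mem_cat mem_filter cx xD.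
    exact: (bowen_ball_sub (leqnn _) le24) xy.
  have [|j jJ [mji ij]] := cJ x; first by rewrite mem_filter nx.
  exists j; first by rewrite mem_cat jJ orbT.
  case: ij => [<-|[z [Vxz Vjz]]].
    exact: (bowen_ball_sub (leqnn _) le24) xy.
  have [_ Vj _] := Jgood j jJ.
  have [_ _ /(_ (asboolPn _ nx))[_ Vx _]] := fP x.
  exact: (bowen_ball_overlap mji (Vj _ Vjz) (Vx _ Vxz)) xy.
rewrite big_cat/= [leRHS]splitr lerD//.
  rewrite (_ : \sum_(x <- B) r ^+ m x = (size B)%:R * r ^+ M); last first.
    rewrite mulr_natl -iter_addr_0 -(count_predT B) -big_const_seq.
    apply: eq_big_seq => x.
    rewrite mem_filter => /andP[/asboolP cx _]; congr (r ^+ _).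
    by have [_ /(_ cx)] := fP x.
  have : (size B)%:R * c <= 1.
    apply: size_clustered; first by rewrite filter_uniq// fset_uniq.
    by move=> x; rewrite mem_filter => /andP[/asboolP].
  have B0 : 0 <= (size B)%:R :> R by exact: ler0n.
  by move: MP; nra.
have : \sum_(x <- J) q ^+ m x <= 1.
  by apply: (sum_visit_rates_le1 (T := T) uJ dJ) => x /Jgood[].
(* r ^ m = (r / q) ^ m q ^ m, and (r / q) ^ m <= (r / q) ^ m0 <= 1 / 2. *)
move=> sJ; rewrite -[leRHS]mulr1 div1r; apply: le_trans (ler_wpM2l _ sJ) => //.
rewrite mulr_sumr big_seq [leRHS]big_seq; apply: ler_sum => x xJ.
have [m0x _ _] := Jgood x xJ.
rewrite -ler_pdivrMr// -expr_div_n; apply: le_trans m0P.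
by rewrite ler_wiXn2l ?(ltW rq0) ?(ltW rq1).
Qed.

End compact.
End bowen.

(** * Invariant measures *)

Lemma sum_indic_lower_bound d (M : measurableType d) (R : realType)
    (mu : probability M R) (A : nat -> set M) (p c : R) n :
  (forall i, measurable (A i)) -> (forall i, mu (A i) = p%:E) ->
  (forall x, c <= \sum_(0 <= i < n) \1_(A i) x) -> c <= p * n%:R.
Proof.
move=> mA muA cA; have p0 : 0 <= p by rewrite -lee_fin -(muA 0%N).
(* Monotonicity of the integral is used for nonnegative functions only. *)
have [neg|pos] := ltP c 0; first by rewrite (le_trans (ltW neg))// mulr_ge0.
pose f i (x : M) : \bar R := (\1_(A i) x)%:E.
have mf i : measurable_fun [set: M] (f i).
  by apply/measurable_EFinP; exact: measurable_indic.
have f0 i x : [set: M] x -> (0 <= f i x)%E by rewrite lee_fin indicE.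
have intf : (\int[mu]_x (\sum_(i <- index_iota 0 n) f i x) = (p * n%:R)%:E)%E.
  rewrite ge0_integral_sum// (eq_bigr (fun=> p%:E)).
    rewrite sumEFin big_const_seq count_predT size_iota subn0.
    by rewrite iter_addr_0 mulr_natr.
  by move=> i _; rewrite /f integral_indic// setIT; exact: muA.
rewrite -lee_fin -intf.
have -> : (c%:E = \int[mu]_x (cst c%:E x))%E.
  by rewrite integral_cst// [X in (_ * X)%E](probability_setT mu) mule1.
apply: ge0_le_integral => //; first exact: emeasurable_sum.
by move=> x _; rewrite sumEFin lee_fin cA.
Qed.

(** * Rates and entropy at a fixed scale *)

Section rates.
Context {R : realType} {X : pointedMetricType R} (T : X -> X).
Implicit Types (V : set X) (x : X).
Implicit Type mu : probability (borel_type X) R.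
Local Open Scope ereal_scope.

Lemma separatesW d e n x y :
  (d <= e)%R -> separates T e n x y -> separates T d n x y.
Proof. exact: le_lt_trans. Qed.

Lemma type1_rate_at_nondecreasing x (d e : R) : (d <= e)%R ->
  type1_rate_at T x d <= type1_rate_at T x e.
Proof.
move=> de; apply: ereal_inf_le_tmp => _ [a [a0 H] <-].
exists a => //; split=> //.
move=> V /H[n [na [y [Vy s]]]]; exists n; split=> //; exists y; split=> //.
exact: separatesW s.
Qed.

Lemma open_measurable_borel V : open V -> measurable (V : set (borel_type X)).
Proof. by move=> oV; apply: sub_sigma_algebra. Qed.

Lemma type1_rateE x :
  type1_rate T x =
  ereal_inf [set type1_rate_at T x d | d in [set d : R | (0 < d)%R]].
Proof.
apply: lim_at_right0_nondecreasing => d e _; exact: type1_rate_at_nondecreasing.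
Qed.

Lemma max_separated_ge1 n (eps : R) : 1 <= max_separated T n eps.
Proof.
apply: ereal_sup_ubound; exists [fset point]%fset; last by rewrite cardfs1.
by move=> y z; rewrite !inE => /eqP -> /eqP ->.
Qed.

Lemma entropy_at_nonincreasing (d e : R) : (d <= e)%R ->
  entropy_at T e <= entropy_at T d.
Proof.
move=> de; apply: le_limn_esup => n; apply: lee_wpmul2l.
  by rewrite lee_fin invr_ge0.
have ge0 eps : max_separated T n eps \in `[0, +oo].
  by rewrite in_itv/= leey andbT (le_trans _ (max_separated_ge1 _ _)).
rewrite lee_lne//; apply: ereal_sup_le => _ [E sE <-]; exists E => //.
move=> y z yE zE /(sE _ _ yE zE)[i iltn s]; exists i => //.
exact: separatesW s.
Qed.

Lemma htopE :
  htop T =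
  ereal_sup [set entropy_at T eps | eps in [set eps : R | (0 < eps)%R]].
Proof.
apply: lim_at_right0_nonincreasing => d e _; exact: entropy_at_nonincreasing.
Qed.

Lemma htop_ge0 : 0 <= htop T.
Proof.
rewrite htopE; apply: le_ereal_sup_tmp.
exists (entropy_at T 1); first by exists 1%R => /=.
apply: limf_esup_ge0 => [|n]; first exact: filter_not_empty.
by rewrite mule_ge0 ?lee_fin ?invr_ge0// lne_ge0 max_separated_ge1.
Qed.

Lemma capacity_le1 V : capacity T V <= 1.
Proof.
apply: ge_ereal_inf.
exists (limn_esup (fun n => (visit_frequency T V point n)%:E)).
  by exists point.
apply: limn_esup_near_le; apply: nearW => n; rewrite lee_fin /visit_frequency.
have [->|n0] := posnP n; first by rewrite big_geq// mulr0.
by rewrite ler_pdivrMl ?ltr0n// mulr1; exact: visits_le.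
Qed.

Lemma entropy_at_le (eps s C : R) : (0 < C)%R ->
  (forall n E, separated_set T n eps E ->
    (#|` E|%:R * expR (- s) ^+ n <= C)%R) ->
  entropy_at T eps <= s%:E.
Proof.
move=> C0 H; rewrite leNgt; apply/negP => /lte_EFin_between[t /andP[st]].
rewrite ltNge => /negP; apply; rewrite lte_fin in st.
have ts : (0 < t - s)%R by rewrite subr_gt0.
have key n : lne (max_separated T n eps) <= (ln C + n%:R * s)%:E.
  have D0 : (0 < C * expR (n%:R * s))%R by rewrite mulr_gt0 ?expR_gt0.
  have -> : ((ln C + n%:R * s)%:E = lne (C * expR (n%:R * s))%:E).
    by rewrite lne_EFin// lnM ?posrE ?expR_gt0// expRK.
  rewrite lee_lne; last 2 first.
  - by rewrite in_itv/= leey andbT (le_trans _ (max_separated_ge1 _ _)).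
  - by rewrite in_itv/= leey andbT lee_fin ltW.
  apply/ereal_supP => _ [E sE <-]; rewrite lee_fin.
  have := H n E sE; rewrite -expRM_natl mulrN expRN.
  by rewrite ler_pdivrMr ?expR_gt0.
apply: limn_esup_near_le; near=> n.
have n0 : (0 < n)%N by near: n; exists 1%N.
apply: le_trans (lee_wpmul2l _ (key n)) _; first by rewrite lee_fin invr_ge0.
rewrite -EFinM lee_fin ler_pdivrMl ?ltr0n//.
suff : (ln C / (t - s) <= n%:R)%R by rewrite ler_pdivrMr// mulrBr lerBrDr.
by near: n; exact: nbhs_infty_ger.
Unshelve. all: by end_near. Qed.

Hypotheses (cptX : compact [set: X]) (contT : continuous T).

(** By invariance the integral of the number of visits to V up to time n is
    n mu(V), and it is bounded below by c n - D for every n. *)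
Lemma visited_at_rate_le_invariant mu V (c : R) :
  invariant_probabilities T mu -> open V -> visited_at_rate T V c ->
  c%:E <= mu (V : set (borel_type X)).
Proof.
move=> inv oV [D VD].
have oTV i : open (iter i T @^-1` V).
  by apply: open_comp => // x _; apply: (@continuous_iter R X T contT).
have muT i : mu (iter i T @^-1` V : set (borel_type X)) =
    mu (V : set (borel_type X)).
  elim: i => [//|i IH].
  rewrite -IH -(inv (iter i T @^-1` V)) //; last exact: open_measurable_borel.
  by congr (mu _); apply/funext => y /=; rewrite -iterSr.
have muV : mu (V : set (borel_type X)) \is a fin_num.
  exact: fin_num_measure (open_measurable_borel oV).
rewrite -(fineK muV) lee_fin; apply: (@le_slope _ _ _ D) => n.
apply: (@sum_indic_lower_bound _ (borel_type X) R mu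
  (fun i => iter i T @^-1` V)).
- by move=> i; exact: open_measurable_borel.
- by move=> i; rewrite (fineK muV) muT.
- by move=> x; exact: VD.
Qed.

Lemma capacity_le_invariant mu V : invariant_probabilities T mu -> open V ->
  capacity T V <= mu (V : set (borel_type X)).
Proof.
move=> inv oV; rewrite leNgt; apply/negP => /lte_EFin_between[c /andP[muc cV]].
have c0 : (0 <= c)%R by rewrite -lee_fin (le_trans _ (ltW muc)).
have visV := visited_lt_capacity cptX contT oV c0 cV.
have := visited_at_rate_le_invariant inv oV visV.
by rewrite leNgt muc.
Qed.

Lemma open_separates d n x : open [set y | separates T d n x y].
Proof.
rewrite (_ : [set _ | _] =
  iter n T @^-1` [set z | (d < mdist (iter n T x) z)%R])//.
apply: open_comp => [z _|]; first exact: (@continuous_iter R X T contT).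
rewrite openE => z /= dz.
have e0 : (0 < mdist (iter n T x) z - d)%R by rewrite subr_gt0.
apply/nbhs_ballP; exists (mdist (iter n T x) z - d)%R => //= w.
rewrite ballEmdist /= => zw.
have := metric_triangle (iter n T x) w z; rewrite (metric_sym w z).
by move: zw; lra.
Qed.

Lemma mu_rate_at_nondecreasing mu x (d e : R) : (d <= e)%R ->
  mu_rate_at T mu x d <= mu_rate_at T mu x e.
Proof.
move=> de; apply: ereal_inf_le_tmp => _ [a [a0 H] <-].
exists a => //; split=> //.
move=> V mV /(H V mV)[n [na s]]; exists n; split=> //; apply: lt_le_trans s _.
have mS eps :=
  measurableI _ _ mV (open_measurable_borel (open_separates eps n x)).
apply: le_measure; rewrite ?inE; [exact: mS..|].
by move=> y [Vy] s; split=> //; exact: separatesW s.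
Qed.

Lemma mu_rateE mu x :
  mu_rate T mu x =
  ereal_inf [set mu_rate_at T mu x d | d in [set d : R | (0 < d)%R]].
Proof.
apply: lim_at_right0_nondecreasing => d e _; exact: mu_rate_at_nondecreasing.
Qed.

Lemma type1_rate_le_mu_rate mu x : invariant_probabilities T mu ->
  type1_rate T x <= mu_rate T mu x.
Proof.
move=> inv; have rate_le d : type1_rate_at T x d <= mu_rate_at T mu x d.
  apply: ereal_inf_le_tmp => _ [a [a0 H] <-].
  exists a => //; split=> // V [oV cV].
  have Vle := capacity_le_invariant inv oV.
  have [n [na sep]] := H V (open_measurable_borel oV) (lt_le_trans cV Vle).
  exists n; split.
    apply: le_trans na _; rewrite leeN2; apply: lee_wpmul2l; first exact: ltW.
    rewrite lee_lne// in_itv/= leey andbT; first exact: ltW.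
    exact: measure_ge0.
  have /set0P[y [Vy s]] : [set y | V y /\ separates T d n x y] != set0.
    by apply: contraTneq sep => ->; rewrite measure0 ltxx.
  by exists y.
rewrite type1_rateE mu_rateE; apply/ereal_infP => _ [d d0 <-].
by apply: ge_ereal_inf; exists (type1_rate_at T x d) => //; exists d.
Qed.

(** If a is not a rate, some open V of positive capacity is never separated
    from x at scale d at the times n <= - a ln c(V).  Taking for m the number of
    those times, V lies in a Bowen ball of length m, and m > - a ln c(V) says
    exp (- m / a) < c(V). *)
Lemma visited_bowen_ball_of_not_rate x (d a : R) : (0 < a)%R ->
  a%:E < type1_rate_at T x d ->
  exists m V, [/\ (0 < m)%N, V `<=` bowen_ball T m x d &
    visited_at_rate T V (expR (- a^-1) ^+ m)].
Proof.
move=> a0 ax.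
have [V [[oV cV0] HV]] : exists V, OC T V /\
    forall n, n%:R%:E <= - (a%:E * lne (capacity T V)) ->
      forall y, V y -> ~ separates T d n x y.
  apply: contrapT => H; move: ax; rewrite ltNge => /negP; apply.
  apply: ereal_inf_lbound; exists a => //; split=> // V oV.
  apply: contrapT => HV; apply: H; exists V; split=> // n na y Vy s.
  by apply: HV; exists n; split=> //; exists y.
have c1 := capacity_le1 V.
have cfin : capacity T V \is a fin_num.
  by rewrite fin_numE; apply/andP; split; apply/eqP => ce; rewrite ce in c1 cV0.
have [k ck] : exists k : R, capacity T V = k%:E.
  by exists (fine (capacity T V)); rewrite fineK.
have vis c : (0 <= c)%R -> (c < k)%R -> visited_at_rate T V c.
  move=> c0 clt; apply: (visited_lt_capacity cptX contT oV c0).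
  by rewrite ck lte_fin.
move: cV0 c1; rewrite ck lte_fin lee_fin => k0 k1; rewrite {}ck in HV.
have lnk : (0 <= - (a * ln k))%R.
  by rewrite oppr_ge0 mulr_ge0_le0 ?(ltW a0)// ln_le0.
(* The times 0, ..., m - 1 are exactly those at most - a ln c(V). *)
pose m := (Num.truncn (- (a * ln k))).+1.
have km : (expR (- a^-1) ^+ m < k)%R.
  rewrite -expRM_natl -[ltRHS](lnK k0) ltr_expR mulrN ltrNl ltr_pdivlMr//.
  by rewrite mulNr mulrC truncnS_gt.
exists m, V; split=> //; last by apply: vis; rewrite ?exprn_ge0 ?expR_ge0.
move=> y Vy i im; rewrite leNgt; apply/negP; apply: HV => //.
rewrite lne_EFin// -EFinM -EFinN lee_fin.
apply: (@le_trans _ _ (Num.truncn (- (a * ln k)))%:R%R).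
  by rewrite ler_nat.
by rewrite truncn_le.
Qed.

Lemma inf_type1_rate_le_inv_htop :
  ereal_inf [set type1_rate T x | x in [set: X]] <= (htop T)^-1.
Proof.
rewrite leNgt; apply/negP => /lte_EFin_between[a /andP[ha aL]].
have h0 := htop_ge0.
have a0 : (0 < a)%R by rewrite -lte_fin (le_lt_trans _ ha)// inve_ge0.
have ah : (a^-1)%:E < htop T.
  have ae0 : 0 <= a%:E by rewrite lee_fin ltW.
  move: ha; rewrite inve_plt; [by rewrite inver gt_eqF|by []..].
have [s /andP[]] := lte_EFin_between ah; rewrite lte_fin htopE => sa.
move=> /ereal_sup_gt[_ [eps /= eps0 <-]]; rewrite ltNge => /negP; apply.
have [|||||C C0 CP] := @card_separated_of_visits R X T cptX contT
    (expR (- a^-1)) (expR (- s)) (eps / 8).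
- exact: expR_gt0.
- by rewrite ltr_expR ltrN2.
- by rewrite -expR0 ler_expR oppr_le0 invr_ge0 ltW.
- by rewrite divr_gt0.
- move=> x e e0; apply: visited_bowen_ball_of_not_rate a0 _.
  apply: (lt_le_trans aL); apply: (@le_trans _ _ (type1_rate T x)).
    by apply: ereal_inf_lbound; exists x.
  by rewrite type1_rateE; apply: ereal_inf_lbound; exists e.
apply: (entropy_at_le C0) => n E sE; apply: CP.
by rewrite mulrC divfK.
Qed.

End rates.

Local Open Scope ereal_scope.

Theorem theoremB (R : realType) (X : pointedMetricType R) (T : X -> X)
    (cptX : compact [set: X]) (contT : continuous T) :
  (forall x : X,
     type1_rate T x <=
       ereal_inf [set mu_rate T mu x | mu in invariant_probabilities T]) /\
  ereal_inf [set type1_rate T x | x in [set: X]] <= (htop T)^-1.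
Proof.
split=> [x|]; last exact: inf_type1_rate_le_inv_htop.
by apply/ereal_infP => _ [mu inv <-]; exact: type1_rate_le_mu_rate.
Qed.
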